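(* Let $\alpha,\beta\in(-\infty,1)$ be such that $\alpha+\beta<\alpha\beta$, let $T:\mathcal H\to\mathcal H$ be an $\alpha$-SPC and $U:\mathcal H\to\mathcal H$ be a $\beta$-SPC with $\operatorname{Fix}(UT)\neq\emptyset$. Let $\tau:\mathcal H\to(0,+\infty)$ be a function such that, for some $z\in\operatorname{Fix}(UT)$ and all $x\in\mathcal H\setminus\operatorname{Fix}(UT)$, $$\frac{2\|a_1+b_1\|^2}{(1-\alpha)\|a_1-a_2\|^2+(1-\beta)\|b_1-b_2\|^2+2\langle a_1-a_2,b_1-b_2\rangle}\le\tau(x)\le\frac{2(\alpha+\beta)}{\alpha+\beta-\alpha\beta},$$ where $a_1:=T(x)-x$, $a_2:=T(z)-z$, $b_1:=UT(x)-T(x)$, $b_2:=UT(z)-T(z)$. Let $x^0\in\mathcal H$ be arbitrary, let $\lambda_k\in[\varepsilon,2-\varepsilon]$, $k\ge0$, for some $\varepsilon\in(0,1)$, and let $$x^{k+1}=x^k+\frac{\lambda_k}{\tau(x^k)}\big(UT(x^k)-x^k\big),\qquad k\ge0.$$ Then $\{x^k\}_{k=0}^\infty$ converges weakly to an element of $\operatorname{Fix}(UT)$.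
   Context: $\mathcal H$ is a real Hilbert space with $\mathcal H\neq\{0\}$; $UT$ denotes the composition $U\circ T$; $\operatorname{Fix}S:=\{z\in\mathcal H:S(z)=z\}$. For $\alpha\in(-\infty,1)$, $T:\mathcal H\to\mathcal H$ is an $\alpha$-strict pseudocontraction ($\alpha$-SPC) if $\|T(x)-T(y)\|^2\le\|x-y\|^2+\alpha\|(T(x)-x)-(T(y)-y)\|^2$ for all $x,y\in\mathcal H$. *)

(* Defs.v *)
From mathcomp Require Export all_boot all_order all_algebra.
From mathcomp Require Export all_classical all_reals all_analysis.
Export Order.TTheory GRing.Theory Num.Theory.
Export numFieldNormedType.Exports.

#[export] Set Implicit Arguments.
#[export] Unset Strict Implicit.
#[export] Unset Printing Implicit Defensive.

Local Open Scope classical_set_scope.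
Local Open Scope ring_scope.

(* [{dot H for idfun}] is the type of symmetric, positive definite bilinear
   forms on [H]. A real Hilbert space is a complete normed module over a
   [realType] whose norm is induced by such a form. *)
Definition induces_norm (R : realType) (H : normedModType R)
    (dot : {dot H for idfun}) : Prop :=
  forall x : H, `|x| ^+ 2 = dot x x.

Definition fix_set (X : Type) (S : X -> X) : set X := [set z | S z = z].

Definition strict_pseudocontraction (R : realType) (H : normedModType R)
    (alpha : R) (T : H -> H) : Prop :=
  forall x y : H,
    `|T x - T y| ^+ 2
      <= `|x - y| ^+ 2 + alpha * `|(T x - x) - (T y - y)| ^+ 2.

Definition weakly_cvg_to (R : realType) (H : normedModType R)
    (dot : {dot H for idfun}) (u : nat -> H) (p : H) : Prop :=
  forall y : H, (fun k => dot (u k) y) @ \oo --> dot p y.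

(* Main.v *)
From mathcomp Require Import ring lra.
Require Import Defs.

(** Write [V = U \o T]. For points [x], [w] put [a = (T x - x) - (T w - w)] and
    [b = (U (T x) - T x) - (U (T w) - T w)], so that
    [a + b = (V x - x) - (V w - w)]. Rewriting the two pseudocontraction
    inequalities through inner products and adding them gives
      [D a b <= 2 <w - x, a + b>],
    where [D a b = (1 - alpha) |a|^2 + (1 - beta) |b|^2 + 2 <a, b>] is the
    denominator that occurs in the bounds on [tau] (lemma [comp_spc_dot]).
    The condition [alpha + beta < alpha * beta] says that the determinant of
    the quadratic form [D] is positive; completing the square yields
    [D a b >= c |a + b|^2] with
    [c = (alpha + beta - alpha * beta) / (alpha + beta) > 0]
    (lemma [displacement_form_ge]). The upper bound on [tau] is [2 / c].

    Three consequences carry the proof.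

    - [Id - V] is cocoercive, hence demiclosed at 0: weak limits of bounded
      families whose residuals [x - V x] tend to 0 are fixed points of [V].

    - [D] is positive definite, so the displacement [T w - w] is the same for
      all fixed points [w] of [V]. The lower bound on [tau], assumed for a
      single fixed point [z], therefore holds for all of them.

    - That lower bound makes the step [(V x - x) / tau x] satisfy
      [|V x - x|^2 <= tau x * <w - x, V x - x>] for every fixed point [w].
      A step relaxed by [lambda] in [[eps, 2 - eps]] then decreases the squared
      distance to [w] by at least [(eps / M)^2 |V x - x|^2], with [M] the upper
      bound on [tau]. The iterates are thus Fejer monotone with respect to the
      fixed points, and their residuals tend to 0.

    Opial's argument concludes: the distance to each fixed point converges, so
    two weak cluster points which are both fixed points must coincide. Cluster
    points are taken along ultrafilters finer than [\oo]. Along an ultrafilter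
    every bounded real function converges, so a bounded family [u] defines a
    bounded linear functional [y |-> lim <u k, y>], and the Riesz
    representation theorem turns it into a weak limit. *)

Local Open Scope classical_set_scope.
Local Open Scope ring_scope.

(** * Inner product and norm *)

Section InnerProduct.
Context (R : realType) (H : normedModType R) (dot : {dot H for idfun}).

Lemma dotC (x y : H) : dot x y = dot y x.
Proof. by rewrite hermC /= expr0 mul1r. Qed.

Context (dot_norm : induces_norm dot).

Lemma sqr_normD (x y : H) :
  `|x + y| ^+ 2 = `|x| ^+ 2 + 2 * dot x y + `|y| ^+ 2.
Proof. by rewrite !dot_norm linearDl !linearD /= (dotC y x); ring. Qed.

Lemma sqr_normZ (t : R) (x : H) : `|t *: x| ^+ 2 = t ^+ 2 * `|x| ^+ 2.
Proof. by rewrite normrZ exprMn real_normK ?num_real. Qed.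

Lemma sqr_normB (x y : H) :
  `|x - y| ^+ 2 = `|x| ^+ 2 - 2 * dot x y + `|y| ^+ 2.
Proof. by rewrite sqr_normD normrN linearN /=; ring. Qed.

(** The norm of [|v| u - |u| v] is nonnegative; expanding its square gives the
    bound after division by [|u| |v|]. *)
Lemma cauchy_schwarz (x y : H) : `|dot x y| <= `|x| * `|y|.
Proof.
suff le_dot u v : dot u v <= `|u| * `|v|.
  rewrite ler_norml le_dot andbT lerNl -(normrN x).
  by rewrite -[leLHS]linearNl; exact: le_dot.
have [->|u0] := eqVneq u 0; first by rewrite linear0l normr0 mul0r.
have [->|v0] := eqVneq v 0; first by rewrite linear0 normr0 mulr0.
have : 0 <= `| `|v| *: u - `|u| *: v| ^+ 2 by exact: sqr_ge0.
have dotZZ a b : dot (a *: u) (b *: v) = a * b * dot u v.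
  by rewrite linearZl_LR linearZ /= mulrA.
rewrite sqr_normB !sqr_normZ dotZZ.
have uv_gt0 : 0 < `|u| * `|v| by rewrite mulr_gt0 ?normr_gt0.
by move=> ?; rewrite -(ler_pM2l uv_gt0); lra.
Qed.

Lemma cvg_dotl (T : Type) (F : set_system T) {FF : Filter F} (u : T -> H)
    (p y : H) :
  u k @[k --> F] --> p -> dot (u k) y @[k --> F] --> dot p y.
Proof.
move=> up; apply/subr_cvg0/norm_cvg0P.
have ub : `|u k - p| * `|y| @[k --> F] --> (0 : R).
  rewrite -(mul0r `|y|); apply: cvgMr_tmp; apply/norm_cvg0P.
  by apply/subr_cvg0.
apply: (squeeze_cvgr _ (cvg_cst 0) ub).
by apply: nearW => k; rewrite normr_ge0 -linearBl cauchy_schwarz.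
Qed.

End InnerProduct.

(** * Riesz representation *)

Section Riesz.
Context (R : realType) (H : completeNormedModType R).
Context (dot : {dot H for idfun}) (dot_norm : induces_norm dot).

(** The representing vector minimises [J y = |y|^2 - 2 f y]. By the
    parallelogram law almost minimisers of [J] are close to each other, so a
    minimising sequence converges, to [p] say. Comparing [J] along a line
    through the sequence and passing to the limit gives the first order
    condition [0 <= 2 t (<p, v> - f v) + t^2 |v|^2] for all [t], which forces
    [<p, v> = f v]. *)
Theorem riesz_representation (f : H -> R) (C : R) :
  scalar f -> (forall y, f y <= C * `|y|) ->
  exists p : H, forall y, dot p y = f y.
Proof.
move=> f_lin f_le.
have f0 : f 0 = 0 by have := f_lin (-1) 0 0; rewrite scaler0 addr0; lra.
have fZ t v : f (t *: v) = t * f v by rewrite -[t *: v]addr0 f_lin f0 addr0.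
have fD v w : f (v + w) = f v + f w.
  by rewrite -[v]scale1r f_lin mul1r scale1r.
pose J y := `|y| ^+ 2 - 2 * f y; pose m := inf (range J).
have J_lb : has_lbound (range J).
  exists (- C ^+ 2) => _ [y _ <-]; rewrite /J.
  have := f_le y; have := sqr_ge0 (`|y| - C); lra.
have J_inf : has_inf (range J) by split; first by exists (J 0), 0.
have m_le y : m <= J y by apply: ge_inf => //; exists y.
have /choice[y_ y_min] n : exists y, J y < m + harmonic n.
  have [_ [y _ <-]] := inf_adherent (@harmonic_gt0 R n) J_inf.
  by exists y.
have gap n k : `|y_ n - y_ k| ^+ 2 <= 2 * (harmonic n + harmonic k).
  (* Parallelogram law: [J] at the midpoint is at least [m]. *)
  have := m_le (2^-1 *: (y_ n + y_ k)); have := y_min n; have := y_min k.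
  rewrite /J sqr_normZ fZ fD (sqr_normD dot_norm) (sqr_normB dot_norm); lra.
have /cvg_ex[p yp] : cvg (y_ @ \oo).
  apply/cauchy_cvgP/cauchy_exP => e e0.
  have small : \forall n \near \oo, (harmonic n : R) < e ^+ 2 / 4.
    by apply: cvgr_lt (@cvg_harmonic R) _ _; rewrite divr_gt0 ?exprn_gt0.
  have [N small_N] := filter_ex small.
  exists (y_ N); apply: (filterS _ small) => n small_n.
  rewrite /= -ball_normE /=.
  rewrite -(ltr_pXn2r (ltn0Sn 1)) ?nnegrE ?(ltW e0) //.
  have := gap N n; lra.
exists p => v; apply/eqP; rewrite -subr_eq0; apply/eqP.
set d := dot p v - f v.
have first_order t : 0 <= 2 * t * d + t ^+ 2 * `|v| ^+ 2.
  have lim_t : 2 * t * (dot (y_ n) v - f v) + t ^+ 2 * `|v| ^+ 2 + harmonic n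
      @[n --> \oo] --> 2 * t * d + t ^+ 2 * `|v| ^+ 2 + 0.
    apply: cvgD; last exact: cvg_harmonic.
    apply: cvgD; last exact: cvg_cst.
    apply: cvgMl_tmp; apply: cvgB; last exact: cvg_cst.
    exact: cvg_dotl.
  rewrite -[leRHS]addr0; apply: (cvgr_to_ge lim_t); apply: nearW => n.
  have := m_le (y_ n + t *: v); have := y_min n.
  rewrite /J (sqr_normD dot_norm) sqr_normZ fD fZ.
  rewrite (_ : dot (y_ n) (t *: v) = t * dot (y_ n) v); last by rewrite linearZ.
  lra.
set s := `|v| ^+ 2 in first_order.
have s0 : 0 <= s by exact: sqr_ge0.
have s1 : 0 < s + 1 by lra.
(* The minimising choice would be [t = - d / s]; the shift by 1 covers
   [s = 0]. *)
have := first_order (- d / (s + 1)).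
have -> : 2 * (- d / (s + 1)) * d + (- d / (s + 1)) ^+ 2 * s
   = - (d ^+ 2 * ((s + 2) / (s + 1) ^+ 2)) by field; lra.
rewrite oppr_ge0 pmulr_lle0; last by rewrite divr_gt0 ?exprn_gt0; lra.
by rewrite exprn_even_le0 //= => /eqP.
Qed.

End Riesz.

(** * Ultrafilters *)

Section Ultrafilters.

Lemma ultra_fmap (S T : Type) (h : S -> T) (F : set_system S) :
  UltraFilter F -> UltraFilter (h @ F).
Proof.
move=> FU; split; first exact: fmap_proper_filter.
move=> G GP FG; rewrite eqEsubset; split=> // A GA.
have [//|hA] := in_ultra_setVsetC (h @^-1` A) FU.
have /FG GnA : (h @ F) (~` A) by exact: hA.
by have [x []] := filter_ex (filterI GA GnA).
Qed.

(** If [A] is not in [F], the sets of [F] all meet the complement of [A], and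
    some ultrafilter contains both [F] and that complement. *)
Lemma ultra_separation (T : Type) (F : set_system T) (A : set T) :
  Filter F ->
  (forall G : set_system T, UltraFilter G -> F `<=` G -> G A) -> F A.
Proof.
move=> FF GA; apply: contrapT => nFA.
have W : ProperFilter (within (~` A) F).
  apply: Build_ProperFilter_ex => B FB; apply: contrapT => B0.
  apply: nFA; apply: (@filterS _ F _ _ _ _ FB) => x Bx; apply: contrapT => nAx.
  by apply: B0; exists x; exact: Bx.
have [G [GU WG]] := ultraFilterLemma W.
have FG : F `<=` G.
  by move=> B FB; apply: WG; apply: filterS FB => x Bx _.
have GnA : G (~` A) by apply: WG; exact: nearW.
by have [x []] := filter_ex (filterI (GA G GU FG) GnA).
Qed.

Lemma cvg_ultraP (T : Type) (S : topologicalType) (F : set_system T)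
    (h : T -> S) (l : S) :
  Filter F ->
  (forall G : set_system T, UltraFilter G -> F `<=` G -> h @ G --> l) ->
  h @ F --> l.
Proof.
move=> FF hG A lA; apply: (ultra_separation (A := h @^-1` A) FF) => G GU FG.
exact: (hG G GU FG A lA).
Qed.

(** Closed bounded intervals are compact. *)
Lemma ultra_bounded_cvg (R : realType) (T : Type) (F : set_system T)
    (h : T -> R) (C : R) :
  UltraFilter F -> (forall k, `|h k| <= C) -> cvg (h k @[k --> F]).
Proof.
move=> FU hC; have := @segment_compact R (- C) C; rewrite compact_ultra.
move=> /(_ _ (ultra_fmap h FU))[|l [_ hl]]; last by apply/cvg_ex; exists l.
by apply: nearW => k; rewrite /= in_itv /= -ler_norml.
Qed.

End Ultrafilters.

(** * Weak limits *)

Section WeakConvergence.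
Context (R : realType) (H : completeNormedModType R).
Context (dot : {dot H for idfun}) (dot_norm : induces_norm dot).

(** Weak compactness of balls, in the form used below: the limits of
    [<u k, y>] along [F] exist and form a bounded linear functional of [y]. *)
Theorem ultra_bounded_weak_cvg (T : Type) (F : set_system T) (u : T -> H)
    (C : R) :
  UltraFilter F -> (forall k, `|u k| <= C) ->
  exists p : H, forall y, dot (u k) y @[k --> F] --> dot p y.
Proof.
move=> FU uC.
have dot_le k y : `|dot (u k) y| <= C * `|y|.
  by rewrite (le_trans (cauchy_schwarz dot_norm _ _))// ler_wpM2r.
have dot_cvg y : cvg (dot (u k) y @[k --> F]).
  exact: (ultra_bounded_cvg FU (dot_le^~ y)).
pose f y := lim (dot (u k) y @[k --> F]).
have f_lin : scalar f.
  move=> t v w; apply: cvg_lim => //.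
  have -> : (fun k => dot (u k) (t *: v + w)) =
            (fun k => t * dot (u k) v + dot (u k) w).
    by apply/funext => k; rewrite linearP.
  by apply: cvgD; [apply: cvgMl_tmp|]; exact: dot_cvg.
have f_le y : f y <= C * `|y|.
  apply: (cvgr_to_le (dot_cvg y)); apply: nearW => k.
  exact: le_trans (ler_norm _) (dot_le k y).
have [p pf] := riesz_representation dot_norm f_lin f_le.
by exists p => y; rewrite pf; exact: dot_cvg.
Qed.

Lemma bounded_of_cvg_dist (u : nat -> H) (w : H) :
  cvgn (fun k => `|u k - w|) -> exists C, forall k, `|u k| <= C.
Proof.
move=> /cvg_seq_bounded[B [_ /(_ (B + 1)) uB]].
exists (B + 1 + `|w|) => k; rewrite -{1}(subrK w (u k)).
rewrite (le_trans (ler_normD _ _))// lerD2r.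
by have := uB _ k I; rewrite /= normr_id; apply; rewrite ltrDl.
Qed.

(** If [p] and [q] are weak limits along two ultrafilters, both lie in [S], and
    [2 <u k, p - q>] differs from [|u k - q|^2 - |u k - p|^2] by a constant,
    so it converges along [\oo]. Its limit computed along either ultrafilter
    is the same, [<p, p - q> = <q, p - q>], whence [p = q]. *)
Theorem opial (S : set H) (u : nat -> H) :
  S !=set0 ->
  (forall w, S w -> cvgn (fun k => `|u k - w|)) ->
  (forall F : set_system nat, UltraFilter F -> \oo `<=` F ->
     forall p, (forall y, dot (u k) y @[k --> F] --> dot p y) -> S p) ->
  exists2 p, S p & weakly_cvg_to dot u p.
Proof.
move=> [w0 Sw0] dist_cvg cluster_S.
have [C uC] := bounded_of_cvg_dist (dist_cvg w0 Sw0).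
have [F0 [F0U F0oo]] := @ultraFilterLemma _ \oo _.
have [p p_lim] := ultra_bounded_weak_cvg F0U uC.
have Sp := cluster_S _ F0U F0oo p p_lim.
exists p => // y; apply: cvg_ultraP => F FU Foo.
have [q q_lim] := ultra_bounded_weak_cvg FU uC.
have Sq := cluster_S _ FU Foo q q_lim.
suff -> : p = q by exact: q_lim.
have cross_cvg : cvgn (fun k => dot (u k) (p - q)).
  have -> : (fun k => dot (u k) (p - q)) =
     (fun k => 2^-1 * (`|u k - q| * `|u k - q| - `|u k - p| * `|u k - p|
               + (`|p| ^+ 2 - `|q| ^+ 2))).
    apply/funext => k.
    rewrite -!expr2 !(sqr_normB dot_norm) linearB /=; lra.
  apply: is_cvgMl_tmp; apply: is_cvgD; last exact: is_cvg_cst.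
  by apply: is_cvgB; apply: is_cvgM; exact: dist_cvg.
set l := lim _ in cross_cvg.
have pl : dot p (p - q) = l.
  by apply: (cvg_unique _ (p_lim _)) => // A lA; apply: F0oo; exact: cross_cvg.
have ql : dot q (p - q) = l.
  by apply: (cvg_unique _ (q_lim _)) => // A lA; apply: Foo; exact: cross_cvg.
apply/eqP; rewrite -subr_eq0 -normr_eq0 -sqrf_eq0 dot_norm.
by rewrite linearBl /= pl ql subrr.
Qed.

(** Apply cocoercivity to [u k] and [p]. The inner product
    [<u k - p, G (u k) - G p>] tends to 0, since [u k - p] is bounded and tends
    weakly to 0 while [G (u k)] tends to 0 in norm; the left-hand side tends to
    [c |G p|^2]. *)
Theorem cocoercive_demiclosed (T : Type) (F : set_system T)
    {FF : ProperFilter F} (G : H -> H) (c C : R) (u : T -> H) (p : H) :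
  0 < c ->
  (forall x y, c * `|G x - G y| ^+ 2 <= dot (x - y) (G x - G y)) ->
  (forall k, `|u k| <= C) ->
  (forall y, dot (u k) y @[k --> F] --> dot p y) ->
  `|G (u k)| @[k --> F] --> (0 : R) -> G p = 0.
Proof.
move=> c0 G_coc uC up Gu.
have dot_up y : dot (u k - p) y @[k --> F] --> (0 : R).
  have -> : (fun k => dot (u k - p) y) = (fun k => dot (u k) y - dot p y).
    by apply/funext => k; rewrite linearBl.
  by apply/subr_cvg0; exact: up.
have dot_Gu : dot (u k - p) (G (u k)) @[k --> F] --> (0 : R).
  apply/norm_cvg0P.
  have ub : (C + `|p|) * `|G (u k)| @[k --> F] --> (0 : R).
    by rewrite -[0](mulr0 (C + `|p|)); exact: cvgMl_tmp.
  apply: (squeeze_cvgr _ (cvg_cst 0) ub); apply: nearW => k.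
  rewrite normr_ge0 (le_trans (cauchy_schwarz dot_norm _ _))// ler_wpM2r//.
  by rewrite (le_trans (ler_normB _ _))// lerD2r.
have norm_Gu : c * `|G (u k) - G p| ^+ 2 @[k --> F] --> c * `|G p| ^+ 2.
  apply: cvgMl_tmp.
  have : G (u k) - G p @[k --> F] --> 0 - G p.
    by apply: cvgB; [exact/norm_cvg0P|exact: cvg_cst].
  move=> /cvg_norm; rewrite sub0r normrN.
  by move=> lim_norm; exact: (cvgM lim_norm lim_norm).
have le0 : c * `|G p| ^+ 2 - (0 - 0) <= 0.
  apply: (cvgr_to_le (cvgB norm_Gu (cvgB dot_Gu (dot_up (G p))))).
  apply: nearW => k; rewrite subr_le0 (le_trans (G_coc _ _))//.
  by rewrite linearB.
move: le0; rewrite !subr0 pmulr_rle0// exprn_even_le0 //= normr_eq0.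
by move=> /eqP.
Qed.

End WeakConvergence.

(** * Compositions of strict pseudocontractions *)

Lemma subBB (V : zmodType) (p q r s : V) :
  (p - q) - (r - s) = (p - r) - (q - s).
Proof. by rewrite opprD addrACA -opprD. Qed.

Section StrictPseudocontractions.
Context (R : realType) (H : normedModType R).
Context (dot : {dot H for idfun}) (dot_norm : induces_norm dot).

(** Expand [|T x - T w|^2] with [T x - T w = (x - w) + a], where [a] is the
    difference of displacements. *)
Lemma spc_dot (alpha : R) (T : H -> H) (x w : H) :
  strict_pseudocontraction alpha T ->
  (1 - alpha) * `|(T x - x) - (T w - w)| ^+ 2
    <= 2 * dot (w - x) ((T x - x) - (T w - w)).
Proof.
move=> /(_ x w); set a := (T x - x) - (T w - w).
have -> : T x - T w = (x - w) + a.
  by rewrite /a subBB [RHS]addrC subrK.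
rewrite (sqr_normD dot_norm) -(opprB w x) linearNl /= normrN; lra.
Qed.

(** The denominator in the lower bound on the extrapolation function. *)
Definition displacement_form (alpha beta : R) (a b : H) : R :=
  (1 - alpha) * `|a| ^+ 2 + (1 - beta) * `|b| ^+ 2 + 2 * dot a b.

Context (alpha beta : R) (beta_lt1 : beta < 1)
  (alpha_beta : alpha + beta < alpha * beta).

Lemma addr_alpha_beta_lt0 : alpha + beta < 0.
Proof.
move: beta_lt1 alpha_beta => b1 ab.
case: (lerP 0 alpha) => a0; case: (lerP 0 beta) => b0; last lra.
- have : 0 <= alpha * (1 - beta) by apply: mulr_ge0; lra.
  lra.
- by have := mulr_ge0_le0 a0 (ltW b0); lra.
- by have := mulr_le0_ge0 (ltW a0) b0; lra.
Qed.

(** Completing the square; this is where the constant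
    [(alpha + beta - alpha * beta) / (alpha + beta)] comes from. *)
Lemma displacement_form_square (a b : H) :
  - (alpha + beta) * displacement_form alpha beta a b =
  (alpha * beta - (alpha + beta)) * `|a + b| ^+ 2
    + `|alpha *: a - beta *: b| ^+ 2.
Proof.
have dotZZ s t : dot (s *: a) (t *: b) = s * t * dot a b.
  by rewrite linearZl_LR linearZ /= mulrA.
rewrite /displacement_form (sqr_normB dot_norm) (sqr_normD dot_norm).
by rewrite dotZZ !sqr_normZ; ring.
Qed.

Lemma cocoercivity_gt0 : 0 < (alpha + beta - alpha * beta) / (alpha + beta).
Proof.
move: alpha_beta => ab; have := addr_alpha_beta_lt0 => s_lt0.
by rewrite -mulrNN mulr_gt0 // ?oppr_gt0 ?invr_lt0 //; lra.
Qed.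

Lemma displacement_form_ge (a b : H) :
  (alpha + beta - alpha * beta) / (alpha + beta) * `|a + b| ^+ 2
    <= displacement_form alpha beta a b.
Proof.
have s_lt0 := addr_alpha_beta_lt0.
rewrite mulrAC ler_ndivrMr //.
have := displacement_form_square a b.
have := sqr_ge0 `|alpha *: a - beta *: b|; lra.
Qed.

(** On the line [b = - a] the form is [- (alpha + beta) |a|^2]. *)
Lemma displacement_form_le0 (a b : H) :
  a + b = 0 -> displacement_form alpha beta a b <= 0 -> a = 0.
Proof.
move=> ab0; have -> : b = - a by apply/eqP; rewrite -addr_eq0 addrC ab0.
rewrite /displacement_form normrN linearN /= -dot_norm => le0.
have s_lt0 := addr_alpha_beta_lt0.
have : `|a| ^+ 2 <= 0 by nra.
by rewrite exprn_even_le0 //= normr_eq0 => /eqP.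
Qed.

Context (T U : H -> H).
Context (T_spc : strict_pseudocontraction alpha T).
Context (U_spc : strict_pseudocontraction beta U).

Lemma comp_displacement (x w : H) :
  (U (T x) - x) - (U (T w) - w) =
  ((T x - x) - (T w - w)) + ((U (T x) - T x) - (U (T w) - T w)).
Proof.
have split_disp y : U (T y) - y = (T y - y) + (U (T y) - T y).
  by rewrite [RHS]addrC addrA subrK.
by rewrite (split_disp x) (split_disp w) opprD addrACA.
Qed.

(** Sum of the inequalities of [spc_dot] for [T] at [x], [w] and for [U] at
    [T x], [T w]. The cross term of the form comes from
    [T w - T x = (w - x) - a]. *)
Lemma comp_spc_dot (x w : H) :
  displacement_form alpha beta
      ((T x - x) - (T w - w)) ((U (T x) - T x) - (U (T w) - T w))
    <= 2 * dot (w - x) ((U (T x) - x) - (U (T w) - w)).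
Proof.
have := spc_dot x w T_spc; have := spc_dot (T x) (T w) U_spc.
rewrite comp_displacement.
set a := T x - x - _; set b := U (T x) - T x - _.
have -> : T w - T x = (w - x) - a.
  by rewrite /a (subBB (T x)) -(opprB x w) (opprB (T x - T w)) addrA addNr add0r opprB.
have -> : dot (w - x - a) b = dot (w - x) b - dot a b by rewrite linearBl.
have -> : dot (w - x) (a + b) = dot (w - x) a + dot (w - x) b.
  by rewrite linearD.
rewrite /displacement_form; lra.
Qed.

Lemma comp_spc_cocoercive (x y : H) :
  (alpha + beta - alpha * beta) / (alpha + beta) / 2
      * `|(x - U (T x)) - (y - U (T y))| ^+ 2
    <= dot (x - y) ((x - U (T x)) - (y - U (T y))).
Proof.
have := le_trans (displacement_form_ge _ _) (comp_spc_dot x y).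
rewrite -comp_displacement.
have -> : (x - U (T x)) - (y - U (T y)) = - ((U (T x) - x) - (U (T y) - y)).
  by rewrite -(opprB (U (T x)) x) -(opprB (U (T y)) y) -opprD.
rewrite normrN linearN /= -(opprB y x) linearNl /= opprK; lra.
Qed.

(** For two fixed points of [U \o T] the right-hand side of [comp_spc_dot]
    vanishes, so the displacement form is nonpositive. *)
Lemma fixed_displacement (z w : H) :
  fix_set (U \o T) z -> fix_set (U \o T) w -> T w - w = T z - z.
Proof.
rewrite /fix_set /= => zfix wfix; apply/eqP; rewrite -subr_eq0; apply/eqP.
have ab0 : (U (T w) - w) - (U (T z) - z) = 0.
  by rewrite zfix wfix !subrr.
apply: (displacement_form_le0 (b := (U (T w) - T w) - (U (T z) - T z))).
  by rewrite -comp_displacement.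
by rewrite (le_trans (comp_spc_dot w z))// ab0 linear0 mulr0.
Qed.

(** The lower bound on [t] refers to the fixed point [z], while the conclusion
    holds for every fixed point [w]: by [fixed_displacement] the form has the
    same value for [w] as for [z]. *)
Lemma extrapolation_cutter (t : R) (z w x : H) :
  0 < t -> fix_set (U \o T) z -> fix_set (U \o T) w ->
  ~ fix_set (U \o T) x ->
  2 * `|U (T x) - x| ^+ 2
    / displacement_form alpha beta
        ((T x - x) - (T z - z)) ((U (T x) - T x) - (U (T z) - T z)) <= t ->
  `|U (T x) - x| ^+ 2 <= t * dot (w - x) (U (T x) - x).
Proof.
move=> t_gt0 z_fix w_fix x_nfix.
have disp_w := fixed_displacement z_fix w_fix.
have disp_Uw : U (T w) - T w = U (T z) - T z.
  rewrite -[U (T w)]/((U \o T) w) w_fix -[U (T z)]/((U \o T) z) z_fix.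
  by rewrite -opprB disp_w opprB.
rewrite -disp_w -disp_Uw => t_ge.
have form_le := comp_spc_dot x w.
have form_ge := displacement_form_ge
  (T x - x - (T w - w)) (U (T x) - T x - (U (T w) - T w)).
rewrite -comp_displacement in form_ge.
have Vw : U (T w) - w = 0 by rewrite -[U _]/((U \o T) _) w_fix subrr.
rewrite Vw subr0 in form_le form_ge.
have r_neq0 : U (T x) - x != 0.
  by rewrite subr_eq0; apply/eqP => x_fix; exact: x_nfix.
have form_gt0 := lt_le_trans
  (mulr_gt0 cocoercivity_gt0 (exprn_gt0 2 (eqbRL (normr_gt0 _) r_neq0))) form_ge.
move: t_ge; rewrite ler_pdivrMr // => t_ge.
have := ler_wpM2l (ltW t_gt0) form_le; lra.
Qed.

End StrictPseudocontractions.

(** * Convergence of the iteration *)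

Lemma cvg0_of_sqr (R : realType) (T : Type) (F : set_system T) {FF : Filter F}
    (f : T -> R) :
  (forall k, 0 <= f k) ->
  f k ^+ 2 @[k --> F] --> (0 : R) -> f k @[k --> F] --> (0 : R).
Proof.
move=> f0 sq0; have -> : f = (fun k => Num.sqrt (f k ^+ 2)).
  by apply/funext => k; rewrite sqrtr_sqr ger0_norm.
by rewrite -sqrtr0; apply: continuous_cvg sq0; exact: sqrt_continuous.
Qed.

Section RelaxedCutter.
Context (R : realType) (H : normedModType R).
Context (dot : {dot H for idfun}) (dot_norm : induces_norm dot).

(** With [mu = l / t], the square of the new distance is
    [|x - w|^2 - 2 mu <w - x, r> + mu^2 |r|^2]; the bound on [|r|^2] makes it at most
    [|x - w|^2 - l (2 - l) / t^2 |r|^2]; finally [l (2 - l) >= eps^2]. *)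
Lemma relaxed_step_fejer (x w r : H) (t M eps l : R) :
  0 < t -> t <= M -> 0 < eps -> eps <= l <= 2 - eps ->
  `|r| ^+ 2 <= t * dot (w - x) r ->
  `|x + (l / t) *: r - w| ^+ 2 + (eps / M) ^+ 2 * `|r| ^+ 2 <= `|x - w| ^+ 2.
Proof.
move=> t0 tM eps0 /andP[l_ge l_le] cut.
have M0 : 0 < M by lra.
rewrite (addrAC x) (sqr_normD dot_norm (x - w)) sqr_normZ.
have -> : dot (x - w) (l / t *: r) = - (l / t * dot (w - x) r).
  by rewrite linearZ /= -(opprB w x) linearNl /= mulrN.
have l_le2 : eps ^+ 2 <= l * (2 - l) by nra.
have step1 : l / t * (`|r| ^+ 2 / t) <= l / t * dot (w - x) r.
  apply: ler_wpM2l; first by rewrite divr_ge0 //; lra.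
  by rewrite ler_pdivrMr // mulrC.
have step2 : (eps / M) ^+ 2 * `|r| ^+ 2 <= l * (2 - l) / t ^+ 2 * `|r| ^+ 2.
  apply: ler_wpM2r; first exact: sqr_ge0.
  rewrite expr_div_n ler_pM ?sqr_ge0 ?invr_ge0 ?sqr_ge0 //.
  by rewrite lef_pV2 ?posrE ?exprn_gt0 // ler_pXn2r // nnegrE; lra.
have -> : `|x - w| ^+ 2 + 2 * - (l / t * dot (w - x) r)
    + (l / t) ^+ 2 * `|r| ^+ 2 =
   `|x - w| ^+ 2 - 2 * (l / t * dot (w - x) r - l / t * (`|r| ^+ 2 / t))
    - l * (2 - l) / t ^+ 2 * `|r| ^+ 2.
  by field; lra.
lra.
Qed.

End RelaxedCutter.

Theorem corollary4p4 (R : realType) (H : completeNormedModType R)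
    (dot : {dot H for idfun}) (dot_norm : induces_norm dot)
    (H_neq0 : exists v : H, v != 0)
    (alpha beta : R) (alpha_lt1 : alpha < 1) (beta_lt1 : beta < 1)
    (alpha_beta : alpha + beta < alpha * beta)
    (T U : H -> H)
    (T_spc : strict_pseudocontraction alpha T)
    (U_spc : strict_pseudocontraction beta U)
    (fix_neq0 : fix_set (U \o T) !=set0)
    (tau : H -> R) (tau_gt0 : forall x, 0 < tau x)
    (z : H) (z_fix : fix_set (U \o T) z)
    (tau_bounds : forall x, ~ fix_set (U \o T) x ->
       let a1 := T x - x in
       let a2 := T z - z in
       let b1 := U (T x) - T x in
       let b2 := U (T z) - T z in
       2 * `|a1 + b1| ^+ 2
         / ((1 - alpha) * `|a1 - a2| ^+ 2 + (1 - beta) * `|b1 - b2| ^+ 2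
            + 2 * dot (a1 - a2) (b1 - b2))
         <= tau x
         <= 2 * (alpha + beta) / (alpha + beta - alpha * beta))
    (eps : R) (eps_bounds : 0 < eps < 1)
    (lambda : nat -> R)
    (lambda_bounds : forall k, eps <= lambda k <= 2 - eps)
    (x : nat -> H)
    (x_rec : forall k,
       x k.+1 = x k + (lambda k / tau (x k)) *: (U (T (x k)) - x k)) :
  exists2 p : H, fix_set (U \o T) p & weakly_cvg_to dot x p.
Proof.
set M := 2 * (alpha + beta) / (alpha + beta - alpha * beta) in tau_bounds.
have c_gt0 := cocoercivity_gt0 beta_lt1 alpha_beta.
have M_gt0 : 0 < M by rewrite /M -mulrA -invf_div mulr_gt0 // invr_gt0.
have eps_gt0 : 0 < eps by case/andP: eps_bounds.
have fejer w k : fix_set (U \o T) w ->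
    `|x k.+1 - w| ^+ 2 + (eps / M) ^+ 2 * `|U (T (x k)) - x k| ^+ 2
      <= `|x k - w| ^+ 2.
  move=> w_fix; rewrite x_rec.
  have [xk_fix|xk_nfix] := pselect (fix_set (U \o T) (x k)).
    have -> : U (T (x k)) - x k = 0 by rewrite -[U _]/((U \o T) _) xk_fix subrr.
    by rewrite scaler0 addr0 normr0 expr0n mulr0 addr0.
  have := tau_bounds _ xk_nfix.
  rewrite /= (addrC (T (x k) - x k)) addrA subrK -/M => /andP[tau_ge tau_le].
  apply: relaxed_step_fejer => //.
  exact: (extrapolation_cutter dot_norm beta_lt1 alpha_beta T_spc U_spc
    (tau_gt0 (x k)) z_fix).
have dist_cvg w : fix_set (U \o T) w -> cvgn (fun k => `|x k - w|).
  move=> w_fix; apply: nonincreasing_is_cvgn; last by exists 0 => _ [k _ <-].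
  apply/nonincreasing_seqP => k.
  rewrite -(ler_pXn2r (ltn0Sn 1)) ?nnegrE //.
  apply: le_trans (fejer w k w_fix); rewrite lerDl.
  by rewrite mulr_ge0 ?sqr_ge0.
(* The residuals are controlled by the decrements of the convergent sequence
   [|x k - z|^2]. *)
have residual0 : `|U (T (x k)) - x k| @[k --> \oo] --> (0 : R).
  have sq_cvg : cvgn (fun k => `|x k - z| * `|x k - z|).
    by apply: is_cvgM; exact: dist_cvg.
  set l := lim _ in sq_cvg.
  have sq_cvgS : `|x k.+1 - z| * `|x k.+1 - z| @[k --> \oo] --> l.
    by rewrite (cvg_shiftS (fun k => `|x k - z| * `|x k - z|)).
  have decr0 : (M / eps) ^+ 2
      * (`|x k - z| * `|x k - z| - `|x k.+1 - z| * `|x k.+1 - z|)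
      @[k --> \oo] --> (0 : R).
    rewrite -[X in _ --> X](mulr0 ((M / eps) ^+ 2)) -(subrr l).
    by apply: cvgMl_tmp; exact: cvgB sq_cvg sq_cvgS.
  have sq0 : `|U (T (x k)) - x k| ^+ 2 @[k --> \oo] --> (0 : R).
    apply: (squeeze_cvgr _ (cvg_cst 0) decr0); apply: nearW => k.
    rewrite sqr_ge0 /= -!expr2 mulrC -ler_pdivrMr; last first.
      by rewrite exprn_gt0 // (divr_gt0 M_gt0).
    rewrite -exprVn invf_div mulrC lerBrDl.
    exact: fejer.
  exact: (cvg0_of_sqr (fun k => normr_ge0 _) sq0).
apply: (opial dot_norm fix_neq0 dist_cvg) => F F_ultra F_oo p p_lim.
have [C xC] := bounded_of_cvg_dist (dist_cvg z z_fix).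
have Gp : p - U (T p) = 0.
  apply: (cocoercive_demiclosed (G := fun y => y - U (T y)) dot_norm
    _ (comp_spc_cocoercive dot_norm beta_lt1 alpha_beta T_spc U_spc) xC p_lim).
    by rewrite divr_gt0.
  have -> : (fun k => `|x k - U (T (x k))|) = (fun k => `|U (T (x k)) - x k|).
    by apply/funext => k; rewrite distrC.
  by move=> A A0; apply: F_oo; exact: residual0.
by rewrite /fix_set /=; apply/esym/eqP; rewrite -subr_eq0 Gp.
Qed.
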